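(* Let $\tilde n\ge 1$ and let $(\tilde{\mathbf{x}},\tilde{\mathbf{z}})\in\mathcal{S}_{\tilde n}$ satisfy $\tilde\delta:=\min_{t\in[0,1]}P_x'(t;\tilde n,\tilde{\mathbf{x}})>0$. For an integer $n\ge 1$, let $(\mathbf{x},\mathbf{z})\in\mathcal{C}_n$ be the control points $$x_i=P_x\bigl(\tfrac{i}{n};\tilde n,\tilde{\mathbf{x}}\bigr),\qquad z_i=P_z\bigl(\tfrac{i}{n};\tilde n,\tilde{\mathbf{z}}\bigr),\qquad i=0,1,\dots,n.$$ Set $$\rho=\frac{\|P_z'(\cdot;\tilde n,\tilde{\mathbf{z}})\|_\infty}{\tilde\delta},\qquad \kappa=\max\bigl(\|P_x''(\cdot;\tilde n,\tilde{\mathbf{x}})\|_\infty,\ \|P_z''(\cdot;\tilde n,\tilde{\mathbf{z}})\|_\infty\bigr).$$ Then $$\Bigl|\frac1m\sum_{j=1}^m\bigl(F_m(X_{(j)})-P_z(t_{(j)};n,\mathbf{z})\bigr)^2-\frac1m\sum_{j=1}^m\bigl(F_m(X_{(j)})-P_z(\tilde t_{(j)};\tilde n,\tilde{\mathbf{z}})\bigr)^2\Bigr|\le\frac{(1+\rho)\kappa}{4n},$$ where, for each $j=1,\dots,m$, $t_{(j)},\tilde t_{(j)}\in[0,1]$ satisfy $P_x(t_{(j)};n,\mathbf{x})=X_{(j)}=P_x(\tilde t_{(j)};\tilde n,\tilde{\mathbf{x}})$.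
   Context: Let $X_{(1)}\le\dots\le X_{(m)}$ be a sorted real sample containing at least two distinct values, so $X_{(1)}<X_{(m)}$. Its empirical cdf is $F_m(x)=\frac1m\,\#\{j: X_{(j)}\le x\}$. For an integer $n\ge 1$ and $0\le i\le n$, $B_{n,i}(t)=\binom{n}{i}t^i(1-t)^{n-i}$ for $t\in[0,1]$ (with $0^0=1$). For $\mathbf{x}=(x_0,\dots,x_n)$ and $\mathbf{z}=(z_0,\dots,z_n)$ in $\mathbb{R}^{n+1}$, set $P_x(t;n,\mathbf{x})=\sum_{i=0}^n B_{n,i}(t)x_i$ and $P_z(t;n,\mathbf{z})=\sum_{i=0}^n B_{n,i}(t)z_i$ for $t\in[0,1]$; primes denote derivatives in $t$, and $\|\cdot\|_\infty$ is the sup norm on $[0,1]$. $\mathcal{S}_n$ is the set of $(\mathbf{x},\mathbf{z})\in\mathbb{R}^{n+1}\times\mathbb{R}^{n+1}$ with $x_0=X_{(1)}$, $x_n=X_{(m)}$, $z_0=0$, $z_n=1$, $P_x'(t;n,\mathbf{x})>0$ for all $t\in(0,1)$, and $P_z'(t;n,\mathbf{z})\ge 0$ for all $t\in[0,1]$. $\mathcal{C}_n$ is the set of $(\mathbf{x},\mathbf{z})\in\mathbb{R}^{n+1}\times\mathbb{R}^{n+1}$ with $x_0=X_{(1)}$, $x_n=X_{(m)}$, $z_0=0$, $z_n=1$, and $x_i\le x_{i+1}$, $z_i\le z_{i+1}$ for $i=0,\dots,n-1$. (The control points $(\mathbf{x},\mathbf{z})$ defined in the claim do belong to $\mathcal{C}_n$.)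 *)

(* Defs.v *)
From HB Require Import structures.
From mathcomp Require Import all_boot all_order all_algebra.
From mathcomp Require Import all_classical all_reals all_analysis.
Set Implicit Arguments.
Unset Strict Implicit.
Unset Printing Implicit Defensive.
Import Order.TTheory GRing.Theory Num.Theory.
Import numFieldNormedType.Exports.
Local Open Scope classical_set_scope.
Local Open Scope ring_scope.

(* A sample of size m.+1 is a function X : 'I_m.+1 -> R, so that the order
   statistics X_(1), ..., X_(m+1) are X ord0, ..., X ord_max. *)
Definition sorted_sample (R : realType) (m : nat) (X : 'I_m.+1 -> R) : Prop :=
  forall i j : 'I_m.+1, (i <= j)%N -> X i <= X j.

Definition ecdf (R : realType) (m : nat) (X : 'I_m.+1 -> R) (x : R) : R :=
  #|[set j : 'I_m.+1 | X j <= x]%SET|%:R / m.+1%:R.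

Definition bernstein (R : realType) (n i : nat) (t : R) : R :=
  'C(n, i)%:R * t ^+ i * (1 - t) ^+ (n - i).

(* Defined for all real t: the two-sided derivatives of this polynomial function
   at 0 and 1 are the one-sided derivatives of its restriction to [0, 1]. *)
Definition bezier (R : realType) (n : nat) (c : 'rV[R]_n.+1) (t : R) : R :=
  \sum_(i < n.+1) bernstein n i t * c ord0 i.

Definition sup_norm01 (R : realType) (f : R -> R) : R :=
  sup [set `|f t| | t in `[0, 1]].

Definition is_minimum_on (R : realType) (A : set R) (f : R -> R) (d : R) : Prop :=
  (exists2 t, A t & f t = d) /\ (forall t, A t -> d <= f t).

Definition endpoint_conditions (R : realType) (m : nat) (X : 'I_m.+1 -> R)
    (n : nat) (x z : 'rV[R]_n.+1) : Prop :=
  [/\ x ord0 ord0 = X ord0, x ord0 ord_max = X ord_max,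
      z ord0 ord0 = 0 & z ord0 ord_max = 1].

Definition S_set (R : realType) (m : nat) (X : 'I_m.+1 -> R) (n : nat) :
    set ('rV[R]_n.+1 * 'rV[R]_n.+1) :=
  [set xz | [/\ endpoint_conditions X xz.1 xz.2,
     forall t : R, 0 < t < 1 -> 0 < derive1 (bezier xz.1) t &
     forall t : R, 0 <= t <= 1 -> 0 <= derive1 (bezier xz.2) t]].

Definition C_set (R : realType) (m : nat) (X : 'I_m.+1 -> R) (n : nat) :
    set ('rV[R]_n.+1 * 'rV[R]_n.+1) :=
  [set xz | endpoint_conditions X xz.1 xz.2 /\
     forall i j : 'I_n.+1, j = i.+1 :> nat ->
       xz.1 ord0 i <= xz.1 ord0 j /\ xz.2 ord0 i <= xz.2 ord0 j].

(* Main.v *)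
Require Import Defs.
From HB Require Import structures.
From mathcomp Require Import all_boot all_order all_algebra.
From mathcomp Require Import all_classical all_reals all_analysis.
From mathcomp Require Import polyrcf ring lra.
Import Order.TTheory GRing.Theory Num.Theory.
Import numFieldNormedType.Exports.
Local Open Scope classical_set_scope.
Local Open Scope ring_scope.

(** With [f = bezier xt] and [g = bezier zt], the curves [bezier x] and
    [bezier z] are the Bernstein approximations [B_n f] and [B_n g].
    Taylor's inequality and the variance [t (1 - t) / n] of the Bernstein
    weights give [|B_n h - h| <= sup |h''| / (8 n)] on the unit interval.
    Since [f (tt j) = X j = B_n f (t j)] and [f' >= delta],
    [|t j - tt j| <= |f (t j) - B_n f (t j)| / delta], so
    [|B_n g (t j) - g (tt j)| <= (1 + rho) kappa / (8 n)]. All residuals lie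
    in [[-1, 1]], where squaring is 2-Lipschitz. *)

Section BernsteinApproximation.
Context {R : realType}.
Implicit Types (p q : {poly R}) (s t : R) (n : nat).

(** * Moments of the Bernstein weights *)

Lemma bernstein_ge0 n i t : 0 <= t <= 1 -> 0 <= bernstein n i t.
Proof.
by move=> /andP[t0 t1]; rewrite /bernstein !mulr_ge0 ?exprn_ge0 ?subr_ge0.
Qed.

Lemma sum_bernstein n t : \sum_(i < n.+1) bernstein n i t = 1.
Proof.
(* Binomial expansion of [((1 - t) + t) ^+ n]. *)
rewrite -[RHS](expr1n _ n) -[X in X ^+ n](subrK t 1) exprDn.
by apply: eq_bigr => i _; rewrite /bernstein -mulr_natl; ring.
Qed.

(* Absorption [(i + 1) C(n + 1, i + 1) = (n + 1) C(n, i)]: it reduces a moment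
   of the binomial weights to a moment of one order less. *)
Lemma sum_bernstein_absorb n t (h : nat -> R) :
  \sum_(i < n.+2) bernstein n.+1 i t * (i%:R * h i) =
  n.+1%:R * t * \sum_(i < n.+1) bernstein n i t * h i.+1.
Proof.
rewrite big_ord_recl mul0r mulr0 add0r mulr_sumr; apply: eq_bigr => i _.
rewrite /bernstein lift0 subSS exprS.
have := congr1 (fun k => k%:R : R) (mul_bin_diag n.+1 i).
rewrite /= !natrM => E.
transitivity (i.+1%:R * 'C(n.+1, i.+1)%:R * (t * t ^+ i * (1 - t) ^+ (n - i) * h i.+1)).
  by ring.
by rewrite -E; ring.
Qed.

Lemma bernstein_mean n t : \sum_(i < n.+1) bernstein n i t * i%:R = n%:R * t.
Proof.
case: n => [|n]; first by rewrite big_ord1 mulr0 mul0r.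
have := sum_bernstein_absorb n t (fun=> 1).
under eq_bigr do rewrite mulr1; under [in RHS]eq_bigr do rewrite mulr1.
by rewrite sum_bernstein mulr1.
Qed.

(** Absorbing one factor [i] leaves the weights of one degree less against [i + 1], that is, their
    mean plus their total mass. *)
Lemma bernstein_second_moment n t :
  \sum_(i < n.+1) bernstein n i t * (i%:R * i%:R) =
  n%:R * t * (1 - t) + (n%:R * t) ^+ 2.
Proof.
case: n => [|n]; first by rewrite big_ord1 !mul0r !mulr0 expr0n addr0.
rewrite (sum_bernstein_absorb n t (fun i => i%:R)).
under eq_bigr do rewrite -natr1 mulrDr mulr1.
by rewrite big_split/= bernstein_mean sum_bernstein -natr1; ring.
Qed.

Lemma bernstein_variance n t : (0 < n)%N ->
  \sum_(i < n.+1) bernstein n i t * (i%:R / n%:R - t) ^+ 2 = t * (1 - t) / n%:R.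
Proof.
move=> n0; have n_neq0 : n%:R != 0 :> R by rewrite pnatr_eq0 -lt0n.
transitivity (n%:R ^- 2 * \sum_(i < n.+1) bernstein n i t * (i%:R * i%:R)
  - 2 * t / n%:R * (\sum_(i < n.+1) bernstein n i t * i%:R)
  + t ^+ 2 * \sum_(i < n.+1) bernstein n i t).
  rewrite !mulr_sumr -sumrB -big_split/=; apply: eq_bigr => i _.
  by field.
by rewrite bernstein_second_moment bernstein_mean sum_bernstein; field.
Qed.

(** The weights are nonnegative with sum 1, so the value is a convex combination of the control
    points. *)
Lemma bezier_itv n (c : 'rV[R]_n.+1) (a b : R) t :
  (forall i, a <= c ord0 i <= b) -> 0 <= t <= 1 -> a <= bezier c t <= b.
Proof.
move=> cab t01; rewrite -[a]mul1r -[b]mul1r -(sum_bernstein n t) !mulr_suml.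
by apply/andP; split; apply: ler_sum => i _;
  rewrite ler_wpM2l ?bernstein_ge0//; case/andP: (cab i).
Qed.

(** Gives access to formal derivatives and to the mean value theorem for polynomials. *)
Lemma bezier_horner n (c : 'rV[R]_n.+1) :
  exists p : {poly R}, bezier c = horner p.
Proof.
exists (\sum_(i < n.+1)
  (('C(n, i)%:R)%:P * 'X ^+ i * (1 - 'X) ^+ (n - i) * (c ord0 i)%:P)).
apply/funext => t; rewrite horner_sum /bezier; apply: eq_bigr => i _.
by rewrite /bernstein !hornerE.
Qed.

(** * Sup norm and Taylor bounds for polynomials on the unit interval *)

Lemma sup_norm01_horner_ge p t : 0 <= t <= 1 ->
  `|p.[t]| <= sup_norm01 (horner p).
Proof.
(* [sup] dominates its set only if the set is bounded above; a bound for [p] on the interval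
   provides this. *)
move=> t01; apply: ub_le_sup; last by exists t => //=; rewrite in_itv.
have [M pM] := poly_itv_bound p 0 1.
by exists M => _ [s + <-] /= => /pM.
Qed.

(** The sign condition puts [c] on the same side of [t] as [s], so that [s] and [t] may come in
    either order. *)
Lemma poly_mvt01 p s t : 0 <= s <= 1 -> 0 <= t <= 1 ->
  exists2 c, 0 <= c <= 1 /\ 0 <= (c - t) * (s - t) &
    p.[s] - p.[t] = p^`().[c] * (s - t).
Proof.
move=> /andP[s0 s1] /andP[t0 t1]; case: (ltgtP s t) => [st|ts|->].
- have [c] := poly_mvt p st; rewrite in_itv/= => /andP[sc ct] E.
  by exists c; [split; nra | rewrite -opprB E; ring].
- have [c] := poly_mvt p ts; rewrite in_itv/= => /andP[tc cs] E.
  by exists c; [split; nra | exact: E].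
- by exists t; [rewrite t0 t1 subrr mul0r | rewrite !subrr mulr0].
Qed.

(* The mean value theorem for [p], then for [p'], writes the remainder as
   [p''(d) (c - t) (s - t)] with [c] between [s] and [t]. *)
Lemma convex_poly_ge_tangent p s t : 0 <= s <= 1 -> 0 <= t <= 1 ->
  (forall c, 0 <= c <= 1 -> 0 <= p^`()^`().[c]) ->
  p.[t] + p^`().[t] * (s - t) <= p.[s].
Proof.
move=> s01 t01 p2_ge0.
have [c [c01 ct] Ec] := poly_mvt01 p s t s01 t01.
have [d [d01 _] Ed] := poly_mvt01 p^`() c t c01 t01.
have := mulr_ge0 (p2_ge0 _ d01) ct; rewrite mulrA -Ed mulrBl -Ec; lra.
Qed.

Lemma poly_taylor_upper p (K : R) s t : 0 <= s <= 1 -> 0 <= t <= 1 ->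
  (forall c, 0 <= c <= 1 -> p^`()^`().[c] <= K) ->
  p.[s] - p.[t] - p^`().[t] * (s - t) <= K / 2 * (s - t) ^+ 2.
Proof.
(* [q] is convex since [q'' = K - p'']; its tangent inequality at [t] rearranges to the claim. *)
move=> s01 t01 p2K; pose q := (K / 2) *: 'X^2 - p.
have q1 : q^`() = K *: 'X - p^`().
  rewrite derivB derivZ derivXn expr1 -[X in _ *: X](scaler_nat 2) scalerA.
  by congr (_ *: _ - _); field.
have q2 : q^`()^`() = K%:P - p^`()^`() by rewrite q1 derivB derivZ derivX alg_polyC.
suff /(@convex_poly_ge_tangent q s t s01 t01) :
    forall c, 0 <= c <= 1 -> 0 <= q^`()^`().[c].
  by rewrite q1 !hornerE/=; lra.
by move=> c c01; rewrite q2 !hornerE subr_ge0 p2K.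
Qed.

Lemma poly_taylor_norm p (K : R) s t : 0 <= s <= 1 -> 0 <= t <= 1 ->
  (forall c, 0 <= c <= 1 -> `|p^`()^`().[c]| <= K) ->
  `|p.[s] - p.[t] - p^`().[t] * (s - t)| <= K / 2 * (s - t) ^+ 2.
Proof.
move=> s01 t01 p2K; rewrite ler_norml; apply/andP; split; last first.
  by apply: poly_taylor_upper => // c /p2K; apply: le_trans; exact: ler_norm.
suff /(@poly_taylor_upper (- p) K s t s01 t01) :
    forall c, 0 <= c <= 1 -> (- p)^`()^`().[c] <= K.
  by rewrite derivN !hornerN; lra.
move=> c /p2K; rewrite !derivN hornerN; apply: le_trans.
by rewrite -normrN ler_norm.
Qed.

(** * Error of the Bernstein approximation *)

Lemma ord_frac_itv n (i : 'I_n.+1) : (0 < n)%N ->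
  0 <= (i%:R / n%:R : R) <= 1.
Proof.
move=> n0.
by rewrite divr_ge0//= ler_pdivrMr ?ltr0n// mul1r ler_nat -ltnS ltn_ord.
Qed.

Lemma bernstein_approx n p (c : 'rV[R]_n.+1) (K : R) t : (0 < n)%N ->
  (forall i : 'I_n.+1, c ord0 i = p.[i%:R / n%:R]) ->
  (forall s, 0 <= s <= 1 -> `|p^`()^`().[s]| <= K) ->
  0 <= t <= 1 -> `|bezier c t - p.[t]| <= K / (8 * n%:R).
Proof.
move=> n0 cE p2K t01.
have n_gt0 : 0 < n%:R :> R by rewrite ltr0n.
have K0 : 0 <= K by exact: le_trans (normr_ge0 _) (p2K _ t01).
(* The linear Taylor term can be subtracted at no cost: the nodes [i / n] have weighted mean [t]. *)
have -> : bezier c t - p.[t] = \sum_(i < n.+1) bernstein n i t *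
    (p.[i%:R / n%:R] - p.[t] - p^`().[t] * (i%:R / n%:R - t)).
  transitivity (bezier c t - p.[t] * (\sum_(i < n.+1) bernstein n i t)
    - p^`().[t] / n%:R * (\sum_(i < n.+1) bernstein n i t * i%:R)
    + p^`().[t] * t * (\sum_(i < n.+1) bernstein n i t)).
    rewrite bernstein_mean sum_bernstein; field; exact: lt0r_neq0.
  rewrite /bezier !mulr_sumr -!sumrB -big_split/=.
  by apply: eq_bigr => i _; rewrite cE; ring.
apply: (@le_trans _ _ (\sum_(i < n.+1)
    bernstein n i t * (K / 2 * (i%:R / n%:R - t) ^+ 2))).
  apply: le_trans (ler_norm_sum _ _ _) _; apply: ler_sum => i _.
  rewrite normrM ger0_norm ?bernstein_ge0// ler_wpM2l ?bernstein_ge0//.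
  by apply: poly_taylor_norm; rewrite ?ord_frac_itv.
under eq_bigr do rewrite mulrCA.
rewrite -mulr_sumr bernstein_variance//.
have -> : K / (8 * n%:R) = K / 2 * (1 / 4 / n%:R).
  by field; exact: lt0r_neq0.
rewrite ler_wpM2l ?divr_ge0// ler_wpM2r ?invr_ge0//.
(* Completing the square gives [t (1 - t) <= 1 / 4], which turns [K / 2] into [K / 8]. *)
have -> : t * (1 - t) = 1 / 4 - (t - 1 / 2) ^+ 2 by field.
by rewrite gerBl sqr_ge0.
Qed.

End BernsteinApproximation.

(** * From curve errors to mean squared residuals *)

Lemma ecdf_itv (R : realType) (m : nat) (X : 'I_m.+1 -> R) (x : R) :
  0 <= ecdf X x <= 1.
Proof.
rewrite /ecdf divr_ge0//= ler_pdivrMr ?ltr0n// mul1r ler_nat.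
by apply: leq_trans (max_card _) _; rewrite card_ord.
Qed.

Lemma ler_norm_sqrB (R : realDomainType) (a b : R) :
  `|a| <= 1 -> `|b| <= 1 -> `|a ^+ 2 - b ^+ 2| <= 2 * `|a - b|.
Proof.
move=> a1 b1; rewrite subr_sqr normrM mulrC ler_wpM2r//.
by apply: le_trans (ler_normD _ _) _; lra.
Qed.

Theorem corollary1 (R : realType) (m : nat) (X : 'I_m.+1 -> R)
  (X_sorted : sorted_sample X)
  (X_distinct : exists i j : 'I_m.+1, X i <> X j)
  (nt : nat) (nt_ge1 : (1 <= nt)%N) (xt zt : 'rV[R]_nt.+1)
  (xzt_S : S_set X (xt, zt))
  (delta : R) (delta_min : is_minimum_on `[0, 1] (derive1 (bezier xt)) delta)
  (delta_gt0 : 0 < delta)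
  (n : nat) (n_ge1 : (1 <= n)%N) (x z : 'rV[R]_n.+1)
  (xz_C : C_set X (x, z))
  (x_def : forall i : 'I_n.+1, x ord0 i = bezier xt (i%:R / n%:R))
  (z_def : forall i : 'I_n.+1, z ord0 i = bezier zt (i%:R / n%:R))
  (t tt : 'I_m.+1 -> R)
  (t_in01 : forall j : 'I_m.+1, 0 <= t j <= 1)
  (t_def : forall j : 'I_m.+1, bezier x (t j) = X j)
  (tt_in01 : forall j : 'I_m.+1, 0 <= tt j <= 1)
  (tt_def : forall j : 'I_m.+1, bezier xt (tt j) = X j) :
  let rho := sup_norm01 (derive1 (bezier zt)) / delta in
  let kappa := Num.max (sup_norm01 (derive1n 2 (bezier xt)))
                       (sup_norm01 (derive1n 2 (bezier zt))) in
  `| m.+1%:R^-1 * \sum_(j < m.+1) (ecdf X (X j) - bezier z (t j)) ^+ 2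
     - m.+1%:R^-1 * \sum_(j < m.+1) (ecdf X (X j) - bezier zt (tt j)) ^+ 2 |
  <= (1 + rho) * kappa / (4 * n%:R).

Proof.
cbv zeta; set rho := _ / delta; set kappa := Num.max _ _.
have [f fE] := bezier_horner _ xt; have [g gE] := bezier_horner _ zt.
have f1E : derive1 (bezier xt) = horner f^`() by rewrite fE -derivE.
have g1E : derive1 (bezier zt) = horner g^`() by rewrite gE -derivE.
have f2E : derive1n 2 (bezier xt) = horner f^`()^`() by rewrite /= f1E -derivE.
have g2E : derive1n 2 (bezier zt) = horner g^`()^`() by rewrite /= g1E -derivE.
have [_ _ g1_ge0] := xzt_S; rewrite /= g1E in g1_ge0.
have [_ f1_ge] := delta_min; rewrite f1E in f1_ge.
have [[_ _ z0 z1] _] := xz_C; rewrite /= in z0 z1.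
have n_gt0 : 0 < n%:R :> R by rewrite ltr0n.
have g_mono (s u : R) : 0 <= s <= 1 -> 0 <= u <= 1 -> s <= u -> g.[s] <= g.[u].
  move=> s01 u01 su; rewrite -subr_ge0.
  have [c [c01 _] ->] := poly_mvt01 g u s u01 s01.
  by rewrite mulr_ge0 ?g1_ge0 ?subr_ge0.
have g01 (s : R) : 0 <= s <= 1 -> 0 <= g.[s] <= 1.
  move=> s01; have /andP[s0 s1] := s01.
  (* The end nodes [0 / n] and [n / n] identify 0 and 1 with [g.[0]] and [g.[1]]; monotonicity does
     the rest. *)
  rewrite -{1}z0 -z1 !z_def gE mul0r divff ?lt0r_neq0//.
  by rewrite !g_mono// ?lexx ?ler01.
have z01 (i : 'I_n.+1) : 0 <= z ord0 i <= 1.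
  by rewrite z_def gE g01// ord_frac_itv.
have rho_ge0 : 0 <= rho.
  rewrite /rho divr_ge0 ?(ltW delta_gt0)// g1E.
  by apply: le_trans (normr_ge0 _) (sup_norm01_horner_ge _ 0 _); rewrite lexx ler01.
have f2K s : 0 <= s <= 1 -> `|f^`()^`().[s]| <= kappa.
  by move=> s01; rewrite /kappa le_max f2E sup_norm01_horner_ge.
have g2K s : 0 <= s <= 1 -> `|g^`()^`().[s]| <= kappa.
  by move=> s01; rewrite /kappa le_max g2E sup_norm01_horner_ge// orbT.
(* The mean value points [c] for [g] and [d] for [f] may differ:
   [|g'(c)| <= rho * delta <= rho * |f'(d)|] uses only uniform bounds. *)
have g_lip s u : 0 <= s <= 1 -> 0 <= u <= 1 ->
    `|g.[s] - g.[u]| <= rho * `|f.[s] - f.[u]|.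
  move=> s01 u01.
  have [c [c01 _] ->] := poly_mvt01 g s u s01 u01.
  have [d [d01 _] ->] := poly_mvt01 f s u s01 u01.
  rewrite !normrM mulrA ler_wpM2r//.
  apply: le_trans (sup_norm01_horner_ge _ _ c01) _.
  rewrite /rho g1E mulrAC ler_pdivlMr// ler_wpM2l//.
    exact: le_trans (normr_ge0 _) (sup_norm01_horner_ge _ _ c01).
  by apply: le_trans (ler_norm _); apply: f1_ge; rewrite /= in_itv.
have dist j : `|bezier z (t j) - g.[tt j]| <= (1 + rho) * kappa / (8 * n%:R).
  have -> : (1 + rho) * kappa / (8 * n%:R) =
      kappa / (8 * n%:R) + rho * (kappa / (8 * n%:R)) by ring.
  (* Through [g.[t j]]: first the approximation error of [g], then [g_lip], where [f.[tt j] = X j =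
     bezier x (t j)] leaves the approximation error of [f]. *)
  rewrite -(subrKA g.[t j]); apply: le_trans (ler_normD _ _) _.
  apply: lerD.
    by apply: bernstein_approx => // i; rewrite z_def gE.
  apply: le_trans (g_lip _ _ (t_in01 j) (tt_in01 j)) _.
  rewrite ler_wpM2l// -[f.[tt j]](congr1 (@^~ (tt j)) fE) tt_def -t_def distrC.
  by apply: bernstein_approx => // i; rewrite x_def fE.
have resid j (y : R) : 0 <= y <= 1 -> `|ecdf X (X j) - y| <= 1.
  move=> /andP[y0 y1]; have /andP[F0 F1] := ecdf_itv R m X (X j).
  by rewrite ler_norml; apply/andP; split; lra.
rewrite -mulrBr -sumrB normrM ger0_norm ?invr_ge0// ler_pdivrMl ?ltr0n//.
apply: le_trans (ler_norm_sum _ _ _) _.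
set C := _ / (4 * _).
(* The average is bounded term by term, each term by [C]. *)
have -> : m.+1%:R * C = \sum_(j < m.+1) C by rewrite sumr_const card_ord mulr_natl.
apply: ler_sum => j _; rewrite gE.
apply: le_trans (ler_norm_sqrB _ _ _ _ _) _.
- exact/resid/bezier_itv.
- exact/resid/g01.
(* The Lipschitz constant 2 of squaring turns the 8 of [dist] into the 4 of the claim. *)
have -> : C = 2 * ((1 + rho) * kappa / (8 * n%:R)).
  by rewrite /C; field; exact: lt0r_neq0.
by rewrite ler_wpM2l// opprB addrC addrA subrK distrC dist.
Qed.
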